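(* Let $G$ be a unicyclic graph with $n$ vertices and maximum degree $\Delta(G)\leq 3$. Then $E(G)=n$ if and only if $G$ is isomorphic to the complete bipartite graph $K_{2,2}$.
   Context: A unicyclic graph is a connected simple graph with cyclomatic number $m-n+1=1$ ($m$ the number of edges). For a simple graph $G$ with adjacency eigenvalues $\lambda_1,\dots,\lambda_n$, the energy is $E(G)=\sum_{i=1}^n|\lambda_i|$. *)

(* Defs.v *)
From HB Require Import structures.
From mathcomp Require Import all_boot all_order all_algebra all_field.

Set Implicit Arguments.
Unset Strict Implicit.
Unset Printing Implicit Defensive.

Import Order.TTheory GRing.Theory Num.Theory.
Local Open Scope ring_scope.

Record sgraph := SGraph {
  vertex :> finType;
  adj : rel vertex;
  adj_sym : symmetric adj;
  adj_irrefl : irreflexive adj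
}.

Definition edges (G : sgraph) : {set {set G}} :=
  [set [set p.1; p.2] | p : G * G & adj p.1 p.2].

Definition degree (G : sgraph) (x : G) : nat := #|[set y | adj x y]|.

Definition max_degree (G : sgraph) : nat := \max_(x : G) degree x.

(* A connected graph is nonempty: without this condition the graph with no
   vertices would be unicyclic, since its cyclomatic number is 0 - 0 + 1. *)
Definition connected (G : sgraph) : Prop :=
  (0 < #|G|)%N /\ forall x y : G, connect (@adj G) x y.

Definition cyclomatic (G : sgraph) : int := #|edges G|%:Z - #|G|%:Z + 1.

Definition unicyclic (G : sgraph) : Prop := connected G /\ cyclomatic G = 1.

Definition adj_mx (G : sgraph) : 'M[algC]_#|G| :=
  \matrix_(i, j) (adj (enum_val i) (enum_val j))%:R.

(* The eigenvalues with algebraic multiplicity. They are real, but it is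
   simplest to take them in algC, where the characteristic polynomial splits. *)
Definition spectrum (G : sgraph) : seq algC :=
  sval (closed_field_poly_normal (char_poly (adj_mx G))).

Lemma char_poly_spectrum (G : sgraph) :
  char_poly (adj_mx G) = \prod_(z <- spectrum G) ('X - z%:P).
Proof.
rewrite /spectrum; case: closed_field_poly_normal => r /= {1}->.
by rewrite (monicP (char_poly_monic _)) scale1r.
Qed.

Definition energy (G : sgraph) : algC := \sum_(z <- spectrum G) `|z|.

Definition isomorphic (G H : sgraph) : Prop :=
  exists2 f : G -> H, bijective f & {mono f : x y / adj x y}.

Section CompleteBipartite.
Variables p q : nat.

Definition Kpq_adj (x y : 'I_p + 'I_q) : bool :=
  match x, y with
  | inl _, inr _ | inr _, inl _ => true
  | _, _ => false
  end.

Lemma Kpq_adj_sym : symmetric Kpq_adj.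
Proof. by case=> ? []. Qed.

Lemma Kpq_adj_irrefl : irreflexive Kpq_adj.
Proof. by case. Qed.

Definition complete_bipartite : sgraph := SGraph Kpq_adj_sym Kpq_adj_irrefl.

End CompleteBipartite.

(* Main.v *)
Require Import Defs.
From HB Require Import structures.
From mathcomp Require Import all_boot all_order all_algebra all_field.
From mathcomp Require Import spectral sesquilinear ring lra zify.

(* Let [A] be the adjacency matrix, [n_i] the number of vertices of degree [i],
   and let [x] range over the absolute values of the eigenvalues. Suppose that
   their sum, the energy, is [n]. There are [n] edges, so the sum of the [x^2]
   is [2n], and the sum of the [x (x - 2)^2 (x + 4) = x^4 - 12 x^2 + 16 x], which
   are nonnegative, is [tr A^4 - 8n = Q - 2 n_2], where [Q] is 8 if the cycle
   has length 4 and 0 otherwise. This bounds [n_2] by [Q / 2 <= 4] and every [x]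
   by some [r < 3]. On the other hand [T = tr (4A - A^3)^2], the sum of the
   [x^2 (x^2 - 4)^2], is bounded from below by counting 3-walks. If
   [Q = 2 n_2] then every [x] is 0 or 2, hence [T = 0], which leaves only the
   4-cycle. Otherwise the cycle has length 4 and [n_2 <= 3], and [T] is too
   large: a combination of [x, x^2, x^4, x^6] that is nonnegative on [0, r] has
   a negative sum. *)

Set Implicit Arguments.
Unset Strict Implicit.
Unset Printing Implicit Defensive.

Import Order.TTheory GRing.Theory Num.Theory.
Local Open Scope ring_scope.

(** * Moments of a finite family of nonnegative reals *)

Section MomentInequalities.
Variable R : realFieldType.
Implicit Types (x r t n c d : R) (s : seq R).

Definition quartic x := x * (x - 2) ^+ 2 * (x + 4).

(* Evaluated at the powers of [x], this is the expansion of
   [x (r - x) (x - t)^2 (u x^2 + u^2 x + 2 t (r + t)^2)] with [u = r + 2 t]: the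
   last factor is chosen so that only [x, x^2, x^4, x^6] occur. *)
Definition sextic r t x1 x2 x4 x6 :=
  2 * r * t ^+ 3 * (r + t) ^+ 2 * x1
  - t ^+ 2 * (3 * r ^+ 3 + 6 * r ^+ 2 * t + 4 * r * t ^+ 2 + 2 * t ^+ 3) * x2
  + (r ^+ 3 + 2 * r ^+ 2 * t + 3 * r * t ^+ 2 + 4 * t ^+ 3) * x4
  - (r + 2 * t) * x6.

Lemma quartic_ge0 x : 0 <= x -> 0 <= quartic x.
Proof. by move=> x0; rewrite mulr_ge0 ?addr_ge0 // mulr_ge0 ?sqr_ge0. Qed.

(** The factors [x], [(x - 2) ^+ 2] and [x + 4] all increase from 2 on, so [r < x] would give
    [quartic r < quartic x]. This turns a bound on a sum of quartics into a bound on every [x]. *)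
Lemma quartic_le x r : 2 <= r -> 0 <= x -> quartic x <= quartic r -> x <= r.
Proof.
move=> r2 x0; rewrite !leNgt; apply: contra => rx.
have sq_lt : (r - 2) ^+ 2 < (x - 2) ^+ 2 by rewrite ltr_pXn2r ?nnegrE //; lra.
have r0 : 0 <= r by lra.
apply: ltr_pM; [by rewrite mulr_ge0 ?sqr_ge0 | lra | | lra].
by rewrite ltr_pM ?sqr_ge0.
Qed.

Lemma sextic_ge0 r t x : 0 <= t -> 0 <= x <= r ->
  0 <= sextic r t x (x ^+ 2) (x ^+ 4) (x ^+ 6).
Proof.
move=> t0 /andP[x0 xr]; set e := (X in 0 <= X).
have -> : e = x * (r - x) * (x - t) ^+ 2 *
    ((r + 2 * t) * x ^+ 2 + (r + 2 * t) ^+ 2 * x + 2 * t * (r + t) ^+ 2).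
  by rewrite /e /sextic; ring.
have r0 := le_trans x0 xr.
have q0 : 0 <= r + 2 * t by rewrite addr_ge0 ?mulr_ge0.
rewrite mulr_ge0 ?addr_ge0 //; first 1 last.
- by rewrite mulr_ge0 ?sqr_ge0.
- by rewrite mulr_ge0 ?sqr_ge0.
- by rewrite mulr_ge0 ?sqr_ge0 ?mulr_ge0.
- by rewrite mulr_ge0 ?sqr_ge0 // mulr_ge0 ?subr_ge0.
Qed.

Variables (s : seq R) (n c d : R).
Hypothesis s_ge0 : {in s, forall x, 0 <= x}.
Hypothesis moment1 : \sum_(x <- s) x = n.
Hypothesis moment2 : \sum_(x <- s) x ^+ 2 = 2 * n.
Hypothesis moment4 : \sum_(x <- s) x ^+ 4 = 8 * n + c.
Hypothesis defect : \sum_(x <- s) (x * (x ^+ 2 - 4)) ^+ 2 = d.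

Lemma sum_quartic : \sum_(x <- s) quartic x = c.
Proof.
have -> : \sum_(x <- s) quartic x =
    \sum_(x <- s) (x ^+ 4 - 12 * x ^+ 2 + 16 * x).
  by apply: eq_bigr => x _; rewrite /quartic; ring.
rewrite big_split /= sumrB -!mulr_sumr moment1 moment2 moment4; ring.
Qed.

Lemma moment_excess_ge0 : 0 <= c.
Proof.
by rewrite -sum_quartic big_seq sumr_ge0 // => x /s_ge0/quartic_ge0.
Qed.

(** The nonnegative quartics sum to 0, so each vanishes. As [x] is nonnegative, the root -4 is
    excluded and [x] is 0 or 2, where [x * (x ^+ 2 - 4)] vanishes too. *)
Lemma moment_excess_eq0 : c = 0 -> d = 0.
Proof.
move=> c0; rewrite -defect big_seq big1 // => x xs; have x0 := s_ge0 xs.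
have /eqP : quartic x = 0.
  apply/eqP; have /eqP := sum_quartic.
  rewrite c0 big_seq psumr_eq0; last by move=> y /s_ge0/quartic_ge0.
  by move=> /allP/(_ x xs); rewrite xs.
rewrite !mulf_eq0 orbb => /orP[/orP[]|] /eqP; first by move->; ring.
  by move/subr0_eq->; ring.
by move=> ?; lra.
Qed.

(** Each [quartic x] is at most the whole sum [c], hence at most [quartic r], so [x <= r] and
    [sextic_ge0] applies. The results add up because [sextic] is linear in its last four
    arguments. *)
Lemma moment_sextic_ge0 r t : 2 <= r -> 0 <= t -> c <= quartic r ->
  0 <= sextic r t n (2 * n) (8 * n + c) (d + 32 * n + 8 * c).
Proof.
move=> r2 t0 cr.
have moment6 : \sum_(x <- s) x ^+ 6 = d + 32 * n + 8 * c.
  have -> : \sum_(x <- s) x ^+ 6 = \sum_(x <- s)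
      ((x * (x ^+ 2 - 4)) ^+ 2 + (8 * x ^+ 4 - 16 * x ^+ 2)).
    by apply: eq_bigr => x _; ring.
  rewrite big_split /= sumrB -!mulr_sumr defect moment2 moment4; ring.
rewrite -moment6 -moment4 -moment2 -[X in sextic _ _ X]moment1 /sextic.
rewrite !mulr_sumr -sumrB -big_split -sumrB big_seq sumr_ge0 // => x xs.
rewrite sextic_ge0 // s_ge0 // quartic_le ?s_ge0 //.
apply: le_trans cr; rewrite -sum_quartic (big_rem x) //= lerDl.
by rewrite big_seq sumr_ge0 // => y /mem_rem/s_ge0/quartic_ge0.
Qed.

End MomentInequalities.

(** * The spectrum *)

Lemma char_poly_similar (F : comUnitRingType) n (P A : 'M[F]_n) :
  P \in unitmx -> char_poly (invmx P *m A *m P) = char_poly A.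
Proof.
move=> Pu; rewrite /char_poly /char_poly_mx.
have PK : map_mx polyC (invmx P) *m map_mx polyC P = 1%:M.
  by rewrite -map_mxM mulVmx // map_mx1.
have -> : 'X%:M - map_mx polyC (invmx P *m A *m P) =
    map_mx polyC (invmx P) *m ('X%:M - map_mx polyC A) *m map_mx polyC P.
  rewrite mulmxBr mulmxBl !map_mxM; congr (_ - _).
  by rewrite -mulmxA -scalar_mxC mulmxA PK mul1mx.
by rewrite !det_mulmx mulrAC -det_mulmx PK det1 mul1r.
Qed.

Section Spectrum.
Variable G : sgraph.

Let A := adj_mx G.
Let sp := spectral_diag A.

Lemma adj_mx_hermsym : A \is hermsymmx.
Proof.
apply: realsym_hermsym.
  apply/is_hermitianmxP; rewrite expr0 scale1r.
  by apply/matrixP => i j; rewrite !mxE adj_sym.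
by apply/mxOverP => i j; rewrite mxE realn.
Qed.

Lemma adj_mx_diag : A = invmx (spectralmx A) *m diag_mx sp *m spectralmx A.
Proof. exact/orthomx_spectralP/hermitian_normalmx/adj_mx_hermsym. Qed.

(** By the spectral theorem the matrix is similar to [diag_mx sp]; a product of factors ['X - z%:P]
    determines the [z] up to order. *)
Lemma perm_spectrum : perm_eq (spectrum G) [seq sp 0 i | i : 'I_#|G|].
Proof.
apply: prod_XsubC_eq; rewrite -char_poly_spectrum -/A adj_mx_diag.
rewrite char_poly_similar ?spectral_unit // char_poly_trig; last first.
  by apply: diag_mx_is_trig.
by rewrite big_image; apply: eq_bigr => i _; rewrite mxE eqxx.
Qed.

Lemma spectrum_real : {in spectrum G, forall z, z \is Num.real}.
Proof.
move=> z; rewrite (perm_mem perm_spectrum) => /imageP[i _ ->].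
exact/mxOverP/hermitian_spectral_diag_real/adj_mx_hermsym.
Qed.

Lemma sum_spectrumX k :
  \sum_(z <- spectrum G) z ^+ k = \tr (iter k (mulmx A) 1%:M).
Proof.
have -> : iter k (mulmx A) 1%:M = invmx (spectralmx A) *m
    diag_mx (\row_i sp 0 i ^+ k) *m spectralmx A.
  elim: k => [|k IH] /=.
    rewrite (_ : diag_mx _ = 1%:M) ?mulmx1 ?mulVmx ?spectral_unit //.
    by apply/matrixP => i j; rewrite !mxE expr0.
  rewrite IH {1}adj_mx_diag -!mulmxA mulKVmx ?spectral_unit //.
  congr (_ *m _); rewrite !mulmxA; congr (_ *m _).
  by apply/matrixP => i j; rewrite mul_diag_mx !mxE exprS mulrnAr.
rewrite mxtrace_mulC mulmxA mulmxV ?spectral_unit // mul1mx mxtrace_diag.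
rewrite (perm_big _ perm_spectrum) big_image.
by apply: eq_bigr => i _; rewrite mxE.
Qed.

(** The absolute values are lifted to [algR], a totally ordered field, where the moment inequalities
    apply. *)
Lemma spectrum_norm : exists2 s : seq algR,
  {in s, forall x, 0 <= x} & map algRval s = map Num.norm (spectrum G).
Proof.
elim: (spectrum G) spectrum_real => [|z r IH] rP; first by exists [::].
have [|s s0 sE] := IH; first by move=> w wr; rewrite rP // inE wr orbT.
exists (in_algR (normr_real z) :: s) => [x|]; last by rewrite /= sE.
by rewrite inE => /predU1P[->|/s0 //]; rewrite -[_ <= _]/(0 <= `|z|).
Qed.

End Spectrum.

(** * Walks *)

Section Walks.
Variable G : sgraph.
Implicit Types (k m : nat) (a b c d u v x y : G).

Fixpoint walks k u v : nat :=
  if k is k'.+1 then (\sum_x adj u x * walks k' x v)%N else (u == v).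

Lemma walksD m k u v :
  walks (m + k) u v = (\sum_x walks m u x * walks k x v)%N.
Proof.
elim: m u => [|m IH] u.
  rewrite (bigD1 u) //= eqxx mul1n big1 ?addn0 // => x.
  by rewrite eq_sym => /negbTE->.
rewrite addSn /=; under eq_bigr do rewrite IH big_distrr /=.
rewrite exchange_big /=; apply: eq_bigr => x _; rewrite big_distrl /=.
by apply: eq_bigr => y _; rewrite mulnA.
Qed.

Lemma walks1 u v : walks 1 u v = adj u v.
Proof.
rewrite /= (bigD1 v) //= eqxx muln1 big1 ?addn0 // => x /negbTE->.
by rewrite muln0.
Qed.

Lemma walks_sym k u v : walks k u v = walks k v u.
Proof.
elim: k u v => [|k IH] u v; first by rewrite /= eq_sym.
rewrite -{1}addn1 walksD [RHS]/=; apply: eq_bigr => x _.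
by rewrite IH walks1 mulnC adj_sym.
Qed.

Lemma sum_adj u : (\sum_v adj u v)%N = degree u.
Proof.
rewrite /degree -sum1dep_card [RHS]big_mkcond.
by apply: eq_bigr => v _; case: adj.
Qed.

Lemma sum_enum_val (V : nmodType) (F : G -> V) :
  \sum_(i < #|G|) F (enum_val i) = \sum_u F u.
Proof.
rewrite [LHS](reindex (@enum_rank G)) /=; last exact/onW_bij/enum_rank_bij.
by apply: eq_bigr => u _; rewrite enum_rankK.
Qed.

Lemma sum_spectrum_walks k :
  \sum_(z <- spectrum G) z ^+ k = (\sum_u walks k u u)%:R.
Proof.
have E i j : iter k (mulmx (adj_mx G)) 1%:M i j =
    (walks k (enum_val i) (enum_val j))%:R.
  elim: k i => [|k IH] i /=; first by rewrite mxE (inj_eq enum_val_inj).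
  rewrite mxE natr_sum -[RHS]sum_enum_val; apply: eq_bigr => l _.
  by rewrite mxE IH natrM.
rewrite sum_spectrumX natr_sum -[RHS]sum_enum_val.
by apply: eq_bigr => i _; rewrite E.
Qed.

Lemma closed_walks2 : (\sum_u walks 2 u u = \sum_(u : G) degree u)%N.
Proof.
apply: eq_bigr => u _; rewrite (walksD 1 1) -sum_adj; apply: eq_bigr => x _.
by rewrite !walks1 adj_sym mulnb andbb.
Qed.

Lemma closed_walks4 :
  (\sum_u walks 4 u u = \sum_(u : G) \sum_(v : G) adj u v * walks 3 u v)%N.
Proof.
apply: eq_bigr => u _; rewrite (walksD 1 3); apply: eq_bigr => x _.
by rewrite walks1 [walks 3 x u]walks_sym.
Qed.

(** A closed 6-walk is cut into two 3-walks, the second read backwards. *)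
Lemma closed_walks6 : (\sum_u walks 6 u u = \sum_u \sum_v walks 3 u v ^ 2)%N.
Proof.
apply: eq_bigr => u _; rewrite (walksD 3 3); apply: eq_bigr => x _.
by rewrite [walks 3 x u]walks_sym mulnn.
Qed.

(** Given the four adjacencies, the two inequalities make all four vertices distinct. Each 4-cycle
    has eight such labellings. *)
Definition square a b c d :=
  [&& adj a b, adj b c, adj c d, adj d a, a != c & b != d].

Lemma square_rot a b c d : square a b c d = square b c d a.
Proof.
rewrite /square [c == a]eq_sym.
case: (adj a b) (adj b c) (adj c d) (adj d a) => [] [] [] [] //=.
by rewrite andbC.
Qed.

Lemma square_rev a b c d : square a b c d = square d c b a.
Proof.
rewrite /square [c == a]eq_sym [d == b]eq_sym.
rewrite (adj_sym d c) (adj_sym c b) (adj_sym b a) (adj_sym a d).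
case: (adj a b) (adj b c) (adj c d) (adj d a) => [] [] [] [] //=.
by rewrite andbC.
Qed.

Definition squares_on u v : nat := (\sum_x \sum_y square u x y v)%N.

(* A 3-walk [u, x, y, v] has [x = v] or [y = u], or closes to a 4-cycle. *)
Lemma walks3_adj u v : adj u v ->
  (walks 3 u v + 1 = degree u + degree v + squares_on u v)%N.
Proof.
move=> uv.
pose t x y := (adj u x && adj x y && adj y v : nat).
have -> : walks 3 u v = (\sum_x \sum_y t x y)%N.
  apply: eq_bigr => x _ /=; rewrite big_distrr /=; apply: eq_bigr => y _.
  by rewrite -/(walks 1 y v) walks1 mulnA !mulnb.
have du : (\sum_x \sum_y (y == u) * t x y = degree u)%N.
  rewrite -sum_adj; apply: eq_bigr => x _; rewrite (bigD1 u) //= eqxx mul1n.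
  rewrite big1 ?addn0 => [|y /negbTE->] //.
  by rewrite /t uv andbT adj_sym andbb.
have dv : (\sum_x \sum_y (x == v) * t x y = degree v)%N.
  rewrite -sum_adj exchange_big; apply: eq_bigr => y _.
  rewrite (bigD1 v) //= eqxx mul1n big1 ?addn0 => [|x /negbTE->] //.
  by rewrite /t uv /= adj_sym andbb adj_sym.
(* Inclusion-exclusion: only the walk [u, v, u, v] has both [x = v] and [y = u]. It accounts for the
   1 on the left-hand side. *)
have duv : (\sum_x \sum_y (x == v) * (y == u) * t x y = 1)%N.
  rewrite (bigD1 v) //= (bigD1 u) //= !eqxx /t uv adj_sym uv.
  rewrite !big1 // => [x /negbTE xv|y /negbTE->]; last by rewrite muln0.
  by rewrite big1 // => y _; rewrite xv.
rewrite -du -dv -[in LHS]duv /squares_on -!big_split /=; apply: eq_bigr => x _.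
rewrite -!big_split /=; apply: eq_bigr => y _; rewrite /t /square.
rewrite (adj_sym v) uv (eq_sym u).
by case: (x == v) (y == u) (adj u x) (adj x y) (adj y v) => [] [] [] [] [].
Qed.

Arguments walks : simpl never.

Lemma sum_walksS k u :
  (\sum_v walks k.+1 u v = \sum_x adj u x * \sum_v walks k x v)%N.
Proof.
by rewrite exchange_big; apply: eq_bigr => x _; rewrite big_distrr.
Qed.

Lemma sum_walks1 u : (\sum_v walks 1 u v = degree u)%N.
Proof. by rewrite -sum_adj; apply: eq_bigr => v _; rewrite walks1. Qed.

(** A 3-walk consists of an oriented middle edge and a neighbour of each of its ends. *)
Lemma sum_walks3 :
  (\sum_u \sum_v walks 3 u v =
   \sum_(u : G) \sum_(v : G) adj u v * (degree u * degree v))%N.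
Proof.
under eq_bigr do rewrite sum_walksS.
rewrite exchange_big; apply: eq_bigr => x _.
rewrite -big_distrl /= sum_walksS; under eq_bigr do rewrite adj_sym.
rewrite sum_adj big_distrr; apply: eq_bigr => y _.
by rewrite sum_walks1 mulnCA.
Qed.

End Walks.

Arguments walks : simpl never.

(** * The cycle space over F_2 *)

Section CycleSpace.
Variable G : sgraph.
Hypothesis G_conn : connected G.
Hypothesis card_edges : #|edges G| = #|G|.
Implicit Types (a b c d u v x y : G) (es : seq {set G}).

Let incidence : 'M['F_2]_(#|edges G|, #|G|) :=
  \matrix_(i, j) ((enum_val j : G) \in (enum_val i : {set G}))%:R.

Lemma edgeP (e : {set G}) :
  reflect (exists2 p : G * G, adj p.1 p.2 & e = [set p.1; p.2]) (e \in edges G).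
Proof.
by apply: (iffP imsetP) => -[p]; rewrite ?inE => ? ->; exists p; rewrite ?inE.
Qed.

Lemma adj_neq a b : adj a b -> a != b.
Proof. by apply: contraTneq => ->; rewrite adj_irrefl. Qed.

Lemma F2_neq0 (z : 'F_2) : z != 0 -> z = 1.
Proof. by case: z => -[|[|k]] //= i _; apply/val_inj. Qed.

(** A kernel vector is a function [f] on the vertices with [f a + f b = 0] along every edge. In
    characteristic 2 this says [f a = f b], and connectedness makes [f] constant. *)
Lemma incidence_ker : (kermx incidence^T <= (const_mx 1 : 'rV_#|G|))%MS.
Proof.
apply/row_subP => r; have := row_sub r (kermx incidence^T).
move: (row r _) => v /sub_kermxP vB0.
pose f x := v 0 (enum_rank x).
have f_adj a b : adj a b -> f a = f b.
  move=> ab; have abE : [set a; b] \in edges G by apply/edgeP; exists (a, b).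
  have /rowP/(_ (enum_rank_in abE [set a; b])) := vB0; rewrite !mxE.
  have -> : \sum_j v 0 j * incidence^T j (enum_rank_in abE [set a; b]) =
      \sum_x f x * (x \in [set a; b])%:R.
    rewrite -sum_enum_val; apply: eq_bigr => j _.
    by rewrite /f enum_valK 2!mxE enum_rankK_in.
  under eq_bigr do rewrite mulr_natr mulrb.
  rewrite -big_mkcond big_setU1 ?inE ?adj_neq //= big_set1 => /eqP.
  by rewrite addr_eq0 (oppr_pchar2 (pchar_Fp (isT : prime 2))) => /eqP.
have f_const x y : f x = f y.
  have /connectP[p xp ->] := G_conn.2 x y.
  by elim: p x xp => //= z p IH x /andP[/f_adj-> /IH].
have [/card_gt0P[x0 _] _] := G_conn.
apply/sub_rVP; exists (f x0); apply/rowP => j.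
by rewrite !mxE mulr1 -(f_const (enum_val j)) /f enum_valK.
Qed.

(** By [incidence_ker] the incidence matrix has rank at least [#|G| - 1], and it has only [#|G|]
    rows. *)
Lemma rank_cycle_space : (\rank (kermx incidence) <= 1)%N.
Proof.
have := mxrankS incidence_ker; rewrite !mxrank_ker mxrank_tr.
by move/leq_trans/(_ (rank_leq_row _)); have := card_edges; lia.
Qed.

Let indicator es : 'rV['F_2]_#|edges G| := \row_i (enum_val i \in es)%:R.

(* The nonzero elements of the cycle space over F_2; by [rank_cycle_space],
   there is at most one. *)
Definition even_edges es :=
  [/\ uniq es, {subset es <= edges G}, es != [::] &
      forall x, ~~ odd (count (fun e : {set G} => x \in e) es)].

Lemma indicator_ker es : even_edges es -> (indicator es <= kermx incidence)%MS.
Proof.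
move=> [es_uniq es_edges _ es_even].
apply/sub_kermxP/rowP => j; rewrite !mxE; set x := enum_val j.
under eq_bigr do rewrite !mxE -/x.
transitivity (\sum_(e in edges G) (e \in es)%:R * (x \in e)%:R : 'F_2).
  by rewrite [RHS]big_enum_val.
transitivity (\sum_(e in es) (x \in e)%:R : 'F_2).
  rewrite [RHS]big_mkcond [LHS]big_mkcond; apply: eq_bigr => e _.
  case: (boolP (e \in es)) => [/es_edges->|_]; first by rewrite mul1r.
  by rewrite mul0r if_same.
rewrite -big_uniq // -natr_sum; apply/eqP.
rewrite -(dvdn_pcharf (pchar_Fp (isT : prime 2))) dvdn2.
suff -> : (\sum_(e <- es) (x \in e))%N = count (fun e : {set G} => x \in e) es.
  exact: es_even.
by rewrite -sum1_count [RHS]big_mkcond; apply: eq_bigr => e _; case: ifP.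
Qed.

Lemma indicator_neq0 es : even_edges es -> indicator es != 0.
Proof.
case: es => [|e es] [_ //= es_edges _ _].
have e_edge : e \in edges G by rewrite es_edges ?mem_head.
apply/eqP => /rowP/(_ (enum_rank_in e_edge e)); rewrite !mxE enum_rankK_in //.
by rewrite mem_head => /eqP; rewrite oner_eq0.
Qed.

(** Over F_2, a space of dimension at most 1 has at most one nonzero vector, and a set of edges is
    determined by its indicator. *)
Lemma even_edges_unique es1 es2 :
  even_edges es1 -> even_edges es2 -> es1 =i es2.
Proof.
move=> es1P es2P.
have : (indicator es2 <= indicator es1)%MS.
  apply: submx_trans (indicator_ker es2P) _.
  rewrite -(geq_leqif (mxrank_leqif_sup (indicator_ker es1P))).
  by rewrite (leq_trans rank_cycle_space) // lt0n mxrank_eq0 indicator_neq0.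
case/sub_rVP => z E.
have z1 : z = 1.
  apply: F2_neq0; apply: contraNneq (indicator_neq0 es2P) => z0.
  by rewrite E z0 scale0r.
move=> e; have [eE|eE] := boolP (e \in edges G).
  have /rowP/(_ (enum_rank_in eE e)) := E.
  rewrite z1 scale1r !mxE enum_rankK_in //.
  by do 2!case: (e \in _).
have [_ /(_ e) n1 _ _] := es1P; have [_ /(_ e) n2 _ _] := es2P.
by rewrite (contraNF n1 eE) (contraNF n2 eE).
Qed.

End CycleSpace.

(** * Four-cycles *)

Lemma set2_eq (T : finType) (a b c d : T) :
  ([set a; b] == [set c; d]) = (a == c) && (b == d) || (a == d) && (b == c).
Proof.
apply/eqP/idP => [E|/orP[]/andP[/eqP-> /eqP->] //]; last exact: setUC.
have Hb : b \in [set c; d] by rewrite -E set22.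
have Hc : c \in [set a; b] by rewrite E set21.
have Hd : d \in [set a; b] by rewrite E set22.
have Ha : a \in [set c; d] by rewrite -E set21.
move: Ha Hb Hc Hd; rewrite !inE.
rewrite (eq_sym c a) (eq_sym c b) (eq_sym d a) (eq_sym d b).
by case: (a == c) (a == d) (b == c) (b == d) => [] [] [] [].
Qed.

Lemma handshake (G : sgraph) : (\sum_(u : G) degree u = 2 * #|edges G|)%N.
Proof.
transitivity (\sum_(p : G * G | adj p.1 p.2) 1)%N.
  rewrite -(pair_big_dep xpredT (fun u v : G => adj u v) (fun _ _ => 1%N)) /=.
  by apply: eq_bigr => u _; rewrite sum1dep_card.
rewrite (partition_big (fun p => [set p.1; p.2]) (mem (edges G))) /=; last first.
  by move=> p pA; apply/edgeP; exists p.
rewrite mulnC -sum_nat_const; apply: eq_bigr => _ /edgeP[[a b] /= ab ->].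
rewrite sum1dep_card (_ : [set _ | _] = [set (a, b); (b, a)]).
  by rewrite cards2 xpair_eqE (negbTE (adj_neq ab)).
apply/setP => -[u v]; rewrite !inE /= set2_eq !xpair_eqE.
apply/andP/orP => [[_ /orP[]]|]; first by left.
  by right.
by case=> /andP[/eqP-> /eqP->]; rewrite ?eqxx ?(adj_sym b) ab ?orbT.
Qed.

(** * Uniqueness of the 4-cycle and absence of chords *)

Section Squares.
Variable G : sgraph.
Implicit Types a b c d u v x y : G.

Lemma degree_gt0 : connected G -> (0 < #|edges G|)%N ->
  forall x, (0 < degree x)%N.
Proof.
move=> [_ conn] /card_gt0P[_ /edgeP[[a b] /= ab _]] x.
apply/card_gt0P; have [->|xa] := eqVneq x a; first by exists b; rewrite inE.
have /connectP[[|y p] /= xp E] := conn x a; first by rewrite E eqxx in xa.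
by exists y; rewrite inE; case/andP: xp.
Qed.

Definition square_edges a b c d : seq {set G} :=
  [:: [set a; b]; [set b; c]; [set c; d]; [set d; a]].

Definition square_pairs a b c d : seq (G * G) :=
  [:: (a, b); (b, a); (b, c); (c, b); (c, d); (d, c); (d, a); (a, d)].

Lemma mem_square_pairs a b c d u v :
  ((u, v) \in square_pairs a b c d) = ([set u; v] \in square_edges a b c d).
Proof. by rewrite !inE !set2_eq !xpair_eqE -!orbA. Qed.

Lemma square_neq a b c d : square a b c d ->
  [/\ a != b, a != c & a != d] /\ [/\ b != c, b != d & c != d].
Proof.
case/and5P=> /adj_neq ab /adj_neq bc /adj_neq cd /adj_neq da /andP[ac bd].
by rewrite ab bc cd ac bd eq_sym da.
Qed.

Lemma square_uniq a b c d : square a b c d -> uniq [:: a; b; c; d].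
Proof.
case/square_neq=> -[ab ac ad] [bc bd cd].
by rewrite /= !inE !negb_or ab ac ad bc bd cd.
Qed.

Lemma square_pairs_uniq a b c d : square a b c d -> uniq (square_pairs a b c d).
Proof.
case/square_neq=> -[ab ac ad] [bc bd cd]; rewrite /= !inE !negb_or !xpair_eqE.
rewrite ?(eq_sym b a) ?(eq_sym c a) ?(eq_sym d a) ?(eq_sym c b) ?(eq_sym d b).
rewrite ?(eq_sym d c) !eqxx !(negbTE ab, negbTE ac, negbTE ad).
by rewrite !(negbTE bc, negbTE bd, negbTE cd).
Qed.

Lemma square_even_edges a b c d :
  square a b c d -> even_edges (square_edges a b c d).
Proof.
move=> sq; case/and5P: (sq) => Aab Abc Acd Ada _.
have [[/negbTE ab /negbTE ac /negbTE ad]] := square_neq sq.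
move=> [/negbTE bc /negbTE bd /negbTE cd].
have [ba ca da] : [/\ (b == a) = false, (c == a) = false & (d == a) = false].
  by split; rewrite eq_sym.
have [cb db dc] : [/\ (c == b) = false, (d == b) = false & (d == c) = false].
  by split; rewrite eq_sym.
split=> //.
- rewrite /= !inE !set2_eq !eqxx.
  by rewrite !(ab, ac, ad, bc, bd, cd, ba, ca, da, cb, db, dc).
- move=> e; rewrite !inE => /or4P[]/eqP->; apply/edgeP.
  + by exists (a, b).
  + by exists (b, c).
  + by exists (c, d).
  + by exists (d, a).
- move=> x; rewrite /= !inE.
  have [->|_] := eqVneq x a; first by rewrite ab ac ad.
  have [->|_] := eqVneq x b; first by rewrite bc bd.
  have [->|_] := eqVneq x c; first by rewrite cd.
  by case: (x == d).
Qed.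

Hypothesis G_conn : connected G.
Hypothesis card_edges : #|edges G| = #|G|.

Lemma square_edges_eq a b c d a' b' c' d' :
  square a b c d -> square a' b' c' d' ->
  square_edges a b c d =i square_edges a' b' c' d'.
Proof.
by move=> /square_even_edges sq /square_even_edges; apply: even_edges_unique.
Qed.

Lemma square_mem_pairs a b c d u x y v :
  square a b c d -> square u x y v -> (u, v) \in square_pairs a b c d.
Proof.
move=> sq sq'; rewrite mem_square_pairs (square_edges_eq sq sq') !inE.
by rewrite [[set v; u]]setUC eqxx !orbT.
Qed.

(** Both labellings have the same edges. The only one at [a] besides [[set d; a]] is [[set a; b]],
    which gives [x = b]; likewise [y = c] at [d]. *)
Lemma square_closing a b c d x y :
  square a b c d -> square a x y d -> x = b /\ y = c.
Proof.
move=> sq sq'; have [[ab ac ad] [bc bd cd]] := square_neq sq.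
have [[ax ay _] [xy xd yd]] := square_neq sq'.
have := square_edges_eq sq sq' [set a; x].
have := square_edges_eq sq sq' [set y; d].
rewrite !inE !set2_eq !eqxx !orbT /= (negbTE ad) (negbTE ac) (negbTE ab).
rewrite (negbTE xd) (negbTE yd) (eq_sym y) (negbTE ay) (eq_sym d b).
rewrite (negbTE bd) (eq_sym d c) (negbTE cd) (eq_sym d a) (negbTE ad) !andbF /=.
by rewrite ?orbF !andbT => /eqP-> /eqP->.
Qed.

Lemma squares_on_eq1 a b c d : square a b c d -> squares_on a d = 1%N.
Proof.
move=> sq; rewrite /squares_on (bigD1 b) //= (bigD1 c) //= sq !big1 //.
  move=> x xb; rewrite big1 // => y _; case: (boolP (square _ _ _ _)) => // sq'.
  by have [xE _] := square_closing sq sq'; rewrite xE eqxx in xb.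
move=> y yc; case: (boolP (square _ _ _ _)) => // sq'.
by have [_ yE] := square_closing sq sq'; rewrite yE eqxx in yc.
Qed.

Lemma squares_onE a b c d u v :
  square a b c d -> squares_on u v = ((u, v) \in square_pairs a b c d) :> nat.
Proof.
move=> sq; have [|nuv] := boolP (_ \in _); last first.
  rewrite /squares_on big1 // => x _; rewrite big1 // => y _.
  case: (boolP (square _ _ _ _)) => // sq'.
  by rewrite (square_mem_pairs sq sq') in nuv.
(* Rotations and reversals bring each of the eight pairs into the position [(a, d)] of
   [squares_on_eq1]. *)
have sq1 := sq; rewrite square_rot in sq1.
have sq2 := sq1; rewrite square_rot in sq2.
have sq3 := sq2; rewrite square_rot in sq3.
rewrite !inE => /or4P[|||/or4P[|||/orP[|]]] /eqP[-> ->];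
  by apply: squares_on_eq1; (eassumption || (rewrite square_rev; eassumption)).
Qed.

(** A chord would close a triangle on [a], [b], [c], a second even set of edges: it does not contain
    [[set c; d]]. *)
Lemma square_chordless a b c d : square a b c d -> adj a c = false.
Proof.
move=> sq; apply/negP => Aac.
have [[/negbTE ab /negbTE ac /negbTE ad]] := square_neq sq.
move=> [/negbTE bc /negbTE bd /negbTE cd]; have /and5P[Aab Abc _ _ _] := sq.
have tri : even_edges [:: [set a; b]; [set b; c]; [set c; a]].
  split=> //.
  - by rewrite /= !inE !set2_eq !eqxx ab ac bc !(eq_sym _ a) ab ac andbF.
  - move=> e; rewrite !inE => /or3P[]/eqP->; apply/edgeP.
    + by exists (a, b).
    + by exists (b, c).
    + by exists (c, a); rewrite // adj_sym.
  - move=> x; rewrite /= !inE.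
    have [->|_] := eqVneq x a; first by rewrite ab ac.
    have [->|_] := eqVneq x b; first by rewrite bc.
    by case: (x == c).
have := even_edges_unique G_conn card_edges (square_even_edges sq) tri [set c; d].
rewrite !inE !set2_eq !eqxx /= !orbT.
by rewrite !(eq_sym _ a) !(eq_sym _ b) ac bc bd ad !(eq_sym d) cd !andbF.
Qed.

End Squares.

(** * Walks of length 3 to the opposite vertex of the 4-cycle *)

Section Antipodes.
Variable G : sgraph.
Implicit Types a b c d u v x y : G.
Hypothesis G_conn : connected G.
Hypothesis card_edges : #|edges G| = #|G|.

(** Otherwise [u, c, b, a] would be a 4-cycle through a vertex off the given one. *)
Lemma square_outside_nonadj a b c d u : square a b c d ->
  u \notin [:: a; b; c; d] -> adj a u -> adj u c = false.
Proof.
move=> sq uC au; apply/negP => uc; have /and5P[ab bc _ _ /andP[ac _]] := sq.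
have ub : u != b by apply: contraNneq uC => ->; rewrite !inE eqxx orbT.
have sq' : square u c b a.
  by rewrite /square uc (adj_sym c) bc (adj_sym b) ab au ub eq_sym.
have := square_mem_pairs G_conn card_edges sq sq'.
by move: uC; rewrite !inE !xpair_eqE; do 4!case: (u == _).
Qed.

(** The two walks are [u, a, b, c] and [u, a, d, c]. *)
Lemma walks3_antipode a b c d u :
  square a b c d -> adj a u -> (2 <= walks 3 u c)%N.
Proof.
move=> sq au; have /and5P[ab bc cd da /andP[ac bd]] := sq.
rewrite (walksD 1 2) (bigD1 a) //= walks1 adj_sym au mul1n.
rewrite (walksD 1 1) (bigD1 b) //= (bigD1 d) 1?eq_sym //= !walks1.
by rewrite ab bc adj_sym da adj_sym cd; lia.
Qed.

Lemma sum_seq4 (F : G -> nat) a b c d : uniq [:: a; b; c; d] ->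
  (\sum_(u in [:: a; b; c; d]) F u = F a + F b + F c + F d)%N.
Proof. by move=> U; rewrite -big_uniq // !big_cons big_nil /= addn0 !addnA. Qed.

Lemma degree_outside a b c d : square a b c d ->
  degree a = (2 + \sum_(u | u \notin [:: a; b; c; d]) adj a u)%N.
Proof.
move=> sq; have U := square_uniq sq; have /and5P[ab _ _ da _] := sq.
rewrite -sum_adj (bigID (mem [:: a; b; c; d])) /= (sum_seq4 _ U).
by rewrite adj_irrefl ab (square_chordless G_conn card_edges sq) (adj_sym a d) da.
Qed.

(** For a nonadjacent pair with [w] 3-walks this is [w^2 - w]; the truncated predecessor is
    harmless, since at [w = 0] the product is 0 anyway. *)
Definition nonadj_excess u v : nat :=
  (~~ adj u v) * (walks 3 u v * (walks 3 u v).-1).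

(** Each neighbour of [a] off the cycle is not adjacent to [c] but has at least two 3-walks to it,
    so its excess is at least 2. *)
Lemma nonadj_excess_antipode a b c d : square a b c d ->
  (2 * degree a <= 4 + \sum_(u | u \notin [:: a; b; c; d]) nonadj_excess u c)%N.
Proof.
move=> sq; rewrite (degree_outside sq) mulnDr leq_add2l big_distrr /=.
apply: leq_sum => u uC; case: (boolP (adj a u)) => //= au.
rewrite /nonadj_excess (square_outside_nonadj sq) //=.
by have := walks3_antipode sq au; case: walks => [|[|k]] // _; lia.
Qed.

(** The bounds at the four cycle vertices are added. They involve pairs with one vertex on the cycle
    and one off it, which the double sum meets in both orders; hence the factor 2. *)
Lemma sum_nonadj_excess a b c d : square a b c d ->
  (4 * (degree a + degree b + degree c + degree d) <=
   32 + \sum_u \sum_v nonadj_excess u v)%N.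
Proof.
move=> sq; set C := [:: a; b; c; d].
have sq1 := sq; rewrite square_rot in sq1.
have sq2 := sq1; rewrite square_rot in sq2.
have sq3 := sq2; rewrite square_rot in sq3.
have out k F : (\sum_(u | u \notin rot k C) F u = \sum_(u | u \notin C) F u)%N.
  by apply: eq_bigl => u; rewrite mem_rot.
have Ha := nonadj_excess_antipode sq; have Hb := nonadj_excess_antipode sq1.
have Hc := nonadj_excess_antipode sq2; have Hd := nonadj_excess_antipode sq3.
rewrite (out 1%N) in Hb; rewrite (out 2%N) in Hc; rewrite (out 3%N) in Hd.
rewrite -/C in Ha.
have sym u v : nonadj_excess u v = nonadj_excess v u.
  by rewrite /nonadj_excess adj_sym walks_sym.
pose H v := (\sum_(u | u \notin C) nonadj_excess u v)%N.
have -> : (\sum_u \sum_v nonadj_excess u v =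
   \sum_(u in C) \sum_v nonadj_excess u v +
   \sum_(u | u \notin C) \sum_v nonadj_excess u v)%N.
  by rewrite (bigID (mem C)).
have H1 : (\sum_(u in C) H u <= \sum_(u in C) \sum_v nonadj_excess u v)%N.
  apply: leq_sum => u _; rewrite (bigID (mem C)) /= addnC.
  by under eq_bigr do rewrite sym; exact: leq_addr.
have H2 : (\sum_(u in C) H u <=
    \sum_(u | u \notin C) \sum_v nonadj_excess u v)%N.
  rewrite exchange_big; apply: leq_sum => u _.
  by rewrite [leqRHS](bigID (mem C)) /= leq_addr.
move: H1 H2; rewrite (sum_seq4 _ (square_uniq sq)) /H; lia.
Qed.

End Antipodes.

(** * Lower bounds for the defect *)

Lemma natz_sum (I : finType) (F : I -> nat) :
  (\sum_i F i)%N%:Z = \sum_i (F i)%:Z.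
Proof. exact: (big_morph Posz PoszD). Qed.

(* The values at 1, 2, 3 are -3, -1, 5. With [w = d + d' - 1] the number of
   3-walks along an edge in no 4-cycle whose ends have degrees [d, d'], they
   satisfy [degree_weight d + degree_weight d' <= 2 ((4 - w)^2 - w + d d')]. *)
Definition degree_weight (k : nat) : int := 2 * k%:Z ^+ 2 - 4 * k%:Z - 1.

Section Defect.
Variable G : sgraph.
Implicit Types a b c d u v x y : G.

(* The squared Frobenius norm of [4A - A^3]. *)
Definition cube_defect : int :=
  \sum_(u : G) \sum_(v : G) (4 * (adj u v)%:Z - (walks 3 u v)%:Z) ^+ 2.

Lemma natz_sum2 (F : G -> G -> nat) :
  (\sum_u \sum_v F u v)%N%:Z = \sum_u \sum_v (F u v)%:Z.
Proof. by rewrite natz_sum; apply: eq_bigr => u _; rewrite natz_sum. Qed.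

(** The trace of [(4A - A^3)^2 = A^6 - 8 A^4 + 16 A^2]. *)
Lemma cube_defect_closed_walks : cube_defect =
  (\sum_(u : G) walks 6 u u)%N%:Z - 8 * (\sum_(u : G) walks 4 u u)%N%:Z
  + 16 * (\sum_(u : G) walks 2 u u)%N%:Z.
Proof.
rewrite closed_walks6 closed_walks4 closed_walks2.
under [X in 16 * X%N%:Z]eq_bigr do rewrite -sum_adj.
rewrite !natz_sum2 !mulr_sumr -sumrB -big_split; apply: eq_bigr => u _.
rewrite !mulr_sumr -sumrB -big_split; apply: eq_bigr => v _ /=.
by case: adj; rewrite ?mul1n ?mul0n; lia.
Qed.

(** By [sum_walks3], the products of degrees over adjacent pairs minus all 3-walk counts sum to 0.
    Adding this difference leaves [w^2 - w] on nonadjacent pairs. *)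
Lemma cube_defect_edges : cube_defect =
  \sum_(u : G) \sum_(v : G) (adj u v)%:Z *
     ((4 - (walks 3 u v)%:Z) ^+ 2 - (walks 3 u v)%:Z
      + (degree u * degree v)%N%:Z)
  + (\sum_(u : G) \sum_(v : G) nonadj_excess u v)%N%:Z.
Proof.
have /(congr1 Posz) := sum_walks3 G; rewrite !natz_sum2 => W.
have {}W : \sum_(u : G) \sum_(v : G)
    ((adj u v)%:Z * (degree u * degree v)%N%:Z - (walks 3 u v)%:Z) = 0.
  under eq_bigr do rewrite sumrB.
  rewrite sumrB W; apply/eqP; rewrite subr_eq0; apply/eqP.
  by apply: eq_bigr => u _; apply: eq_bigr => v _; rewrite PoszM.
apply: etrans (esym (addr0 _)) _; rewrite -[X in _ + X]W.
rewrite -!big_split; apply: eq_bigr => u _.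
rewrite -!big_split; apply: eq_bigr => v _ /=.
by rewrite /nonadj_excess; case: adj => /=; case: walks => [|k] /=; lia.
Qed.

Lemma sum_adj_degrees (F : nat -> int) :
  \sum_(u : G) \sum_(v : G) (adj u v)%:Z * (F (degree u) + F (degree v)) =
  2 * \sum_(u : G) (degree u)%:Z * F (degree u).
Proof.
have E : \sum_(u : G) \sum_(v : G) (adj u v)%:Z * F (degree u) =
    \sum_(u : G) (degree u)%:Z * F (degree u).
  by apply: eq_bigr => u _; rewrite -mulr_suml -natz_sum sum_adj.
rewrite mulr_natl mulr2n -{1}E -E [X in _ + X]exchange_big -big_split.
apply: eq_bigr => u _; rewrite -big_split; apply: eq_bigr => v _.
by rewrite mulrDr [in X in _ + X]adj_sym.
Qed.

(** [walks3_adj] is summed over adjacent pairs; each vertex [u] occurs [degree u] times at either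
    end. *)
Lemma closed_walks4_squares :
  (\sum_(u : G) walks 4 u u)%N%:Z =
  \sum_(u : G) (2 * (degree u)%:Z ^+ 2 - (degree u)%:Z)
  + (\sum_(u : G) \sum_(v : G) adj u v * squares_on u v)%N%:Z.
Proof.
have -> : \sum_(u : G) (2 * (degree u)%:Z ^+ 2 - (degree u)%:Z) =
    \sum_(u : G) \sum_(v : G) (adj u v)%:Z * ((degree u)%:Z + (degree v)%:Z - 1).
  rewrite sumrB -mulr_sumr; under eq_bigr do rewrite expr2.
  rewrite -(sum_adj_degrees Posz) -sumrB; apply: eq_bigr => u _.
  rewrite -[in X in _ - X]sum_adj natz_sum -sumrB; apply: eq_bigr => v _; ring.
rewrite closed_walks4 !natz_sum2 -big_split; apply: eq_bigr => u _.
rewrite -big_split; apply: eq_bigr => v _ /=.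
by case: (boolP (adj u v)) => [/walks3_adj|_]; lia.
Qed.


(** The nonadjacent pairs are dropped, and the inequality for [degree_weight] is applied to each
    adjacent pair; it is checked for all degrees from 1 to 3. *)
Lemma cube_defect_squarefree :
  (forall u v : G, squares_on u v = 0%N) -> (forall u : G, 0 < degree u <= 3)%N ->
  \sum_(u : G) (degree u)%:Z * degree_weight (degree u) <= cube_defect.
Proof.
move=> sq0 deg; rewrite -(ler_pM2l (ltr0n _ 2)) -sum_adj_degrees.
rewrite cube_defect_edges mulrDr ler_wpDr // mulr_sumr ler_sum // => u _.
rewrite mulr_sumr ler_sum // => v _; case: (boolP (adj u v)) => [uv|]; last by lia.
have := walks3_adj uv; rewrite sq0 addn0 => w3.
have -> : (walks 3 u v = degree u + degree v - 1)%N by lia.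
move: (deg u) (deg v); rewrite /degree_weight.
by case: (degree u) => [|[|[|[|k]]]] //; case: (degree v) => [|[|[|[|l]]]].
Qed.

(* What an edge gains in the bound above if it lies on a 4-cycle, where
   [w = d + d']. *)
Definition edge_bonus u v : int :=
  2 * ((4 - (degree u)%:Z - (degree v)%:Z) ^+ 2 - (degree u)%:Z - (degree v)%:Z
       + (degree u)%:Z * (degree v)%:Z)
  - degree_weight (degree u) - degree_weight (degree v).

Lemma sum_pairs (V : nmodType) (F : G -> G -> V) a b c d : square a b c d ->
  \sum_u \sum_v F u v *+ ((u, v) \in square_pairs a b c d) =
  \sum_(p <- square_pairs a b c d) F p.1 p.2.
Proof.
move=> sq; rewrite (big_uniq _ (square_pairs_uniq sq)) /=.
rewrite pair_big [RHS]big_mkcond; apply: eq_bigr => -[u v] _ /=.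
by rewrite mulrb.
Qed.

Lemma adj_square_pairs a b c d u v :
  square a b c d -> (u, v) \in square_pairs a b c d -> adj u v.
Proof.
move/and5P=> [ab bc cd da _].
by rewrite !inE => /or4P[|||/or4P[|||/orP[|]]] /eqP[-> ->]; rewrite // adj_sym.
Qed.

Hypothesis G_conn : connected G.
Hypothesis card_edges : #|edges G| = #|G|.

Lemma sum_squares_on a b c d : square a b c d ->
  (\sum_(u : G) \sum_(v : G) adj u v * squares_on u v = 8)%N.
Proof.
move=> sq; apply: etrans (etrans (sum_pairs (fun _ _ => 1%N) sq) _); last first.
  by rewrite big_const_seq count_predT.
apply: eq_bigr => u _; apply: eq_bigr => v _.
rewrite (squares_onE G_conn card_edges _ _ sq).
have := @adj_square_pairs a b c d u v sq.
by case: (_ \in _) => [->|_]; rewrite ?muln0.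
Qed.

(** The bound of the squarefree case is kept off the cycle. On the cycle edges [edge_bonus] makes it
    exact, and the nonadjacent pairs are bounded by [sum_nonadj_excess]. *)
Lemma cube_defect_square a b c d :
  square a b c d -> (forall u : G, 0 < degree u <= 3)%N ->
  \sum_(u : G) (degree u)%:Z * degree_weight (degree u)
  + (edge_bonus a b + edge_bonus b c + edge_bonus c d + edge_bonus d a)
  + 4 * ((degree a)%:Z + (degree b)%:Z + (degree c)%:Z + (degree d)%:Z) - 32
  <= cube_defect.
Proof.
move=> sq deg; have X := sum_nonadj_excess G_conn card_edges sq.
rewrite cube_defect_edges; set S := (\sum_u \sum_v nonadj_excess u v)%N in X *.
suff : 2 * \sum_(u : G) (degree u)%:Z * degree_weight (degree u)
    + 2 * (edge_bonus a b + edge_bonus b c + edge_bonus c d + edge_bonus d a) <=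
    2 * (\sum_(u : G) \sum_(v : G) (adj u v)%:Z *
     ((4 - (walks 3 u v)%:Z) ^+ 2 - (walks 3 u v)%:Z
      + (degree u * degree v)%N%:Z)).
  move: (\sum_u _) (\sum_u _) (edge_bonus a b) (edge_bonus b c).
  move: (edge_bonus c d) (edge_bonus d a); lia.
have <- : \sum_u \sum_v edge_bonus u v *+ ((u, v) \in square_pairs a b c d) =
    2 * (edge_bonus a b + edge_bonus b c + edge_bonus c d + edge_bonus d a).
  rewrite sum_pairs // !big_cons big_nil /= /edge_bonus; ring.
rewrite -sum_adj_degrees mulr_sumr -big_split ler_sum // => u _.
rewrite mulr_sumr -big_split ler_sum // => v _ /=.
have := squares_onE G_conn card_edges u v sq.
case: (boolP (_ \in _)) => [/(adj_square_pairs sq) uv|_] sq_uv.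
  rewrite uv; have := walks3_adj uv; rewrite sq_uv /edge_bonus mulr1n => w3.
  have -> : (walks 3 u v = degree u + degree v)%N by lia.
  lia.
case: (boolP (adj u v)) => [uv|]; last by lia.
have := walks3_adj uv; rewrite sq_uv addn0 => w3.
have -> : (walks 3 u v = degree u + degree v - 1)%N by lia.
move: (deg u) (deg v); rewrite /degree_weight.
by case: (degree u) => [|[|[|[|k]]]] //; case: (degree v) => [|[|[|[|l]]]].
Qed.

End Defect.

(** * Energy *)

Section NormMoments.
Variables (G : sgraph) (s : seq algR).
Hypothesis sE : map algRval s = map Num.norm (spectrum G).

Lemma energy_norms : energy G = algRval (\sum_(x <- s) x).
Proof.
by rewrite /energy -(big_map Num.norm xpredT id) -sE big_map rmorph_sum.
Qed.

(** The eigenvalues are real, so even powers do not see their signs. *)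
Lemma even_moment k :
  \sum_(x <- s) x ^+ (2 * k) = (\sum_(u : G) walks (2 * k) u u)%:R.
Proof.
apply: (fmorph_inj algRval); rewrite rmorph_nat -sum_spectrum_walks rmorph_sum.
under eq_bigr do rewrite rmorphXn.
rewrite -(big_map algRval xpredT (fun z => z ^+ (2 * k))) sE big_map.
rewrite big_seq [RHS]big_seq; apply: eq_bigr => z zG.
by rewrite !exprM real_normK ?(spectrum_real zG).
Qed.

Lemma sum_cube_defect :
  \sum_(x <- s) (x * (x ^+ 2 - 4)) ^+ 2 = (cube_defect G)%:~R.
Proof.
have -> : \sum_(x <- s) (x * (x ^+ 2 - 4)) ^+ 2 =
    \sum_(x <- s) (x ^+ 6 - 8 * x ^+ 4 + 16 * x ^+ 2).
  by apply: eq_bigr => x _; ring.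
rewrite big_split /= sumrB -!mulr_sumr.
rewrite (even_moment 1) (even_moment 2) (even_moment 3).
by rewrite cube_defect_closed_walks intrD intrB !intrM -!pmulrn.
Qed.

End NormMoments.

Lemma sum4 (F : complete_bipartite 2 2 -> nat) :
  (\sum_x F x =
   F (inl ord0) + F (inl ord_max) + (F (inr ord0) + F (inr ord_max)))%N.
Proof.
rewrite big_sumType /= !big_ord_recl !big_ord0 !addn0.
by do ![congr addn]; congr F; congr (_ _); apply: val_inj.
Qed.

Lemma walks3_K22 (p q : complete_bipartite 2 2) : walks 3 p q = (4 * adj p q)%N.
Proof.
rewrite (walksD 1 2) sum4 !(walksD 1 1) !sum4 !walks1.
by case: p q => i [] j.
Qed.

Lemma walks_iso (G H : sgraph) (f : G -> H) : bijective f ->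
  {mono f : x y / adj x y} -> forall k u v, walks k u v = walks k (f u) (f v).
Proof.
move=> f_bij f_mono; elim=> [|k IH] u v.
  by rewrite /walks (inj_eq (bij_inj f_bij)).
rewrite !(walksD 1 k) [RHS](reindex f) /=; last exact: onW_bij.
by apply: eq_bigr => x _; rewrite !walks1 f_mono IH.
Qed.

(** Here [A^3 = 4A], so the defect is 0 and every absolute value [x] is 0 or 2, whence [x^2 = 2x].
    As the [x^2] sum to [2n], the [x] sum to [n]. *)
Lemma energy_K22 (G : sgraph) : unicyclic G ->
  isomorphic G (complete_bipartite 2 2) -> energy G = #|G|%:R.
Proof.
move=> [_ cyc] [f f_bij f_mono]; have [s s0 sE] := spectrum_norm G.
have card_edges : #|edges G| = #|G| by move: cyc; rewrite /cyclomatic; lia.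
have T0 : cube_defect G = 0.
  rewrite /cube_defect big1 // => u _; rewrite big1 // => v _.
  by rewrite (walks_iso f_bij f_mono) walks3_K22 f_mono PoszM subrr expr0n.
have S2 : \sum_(x <- s) x ^+ 2 = (2 * #|G|)%:R.
  by rewrite (even_moment sE 1) closed_walks2 handshake card_edges.
have S0 : \sum_(x <- s) (x * (x ^+ 2 - 4)) ^+ 2 = 0.
  by rewrite (sum_cube_defect sE) T0.
rewrite (energy_norms sE) -(rmorph_nat algRval); congr algRval.
have : \sum_(x <- s) (x ^+ 2 - 2 * x) = 0.
  rewrite big_seq big1 // => x xs; have x0 := s0 _ xs.
  have : (x * (x ^+ 2 - 4)) ^+ 2 == 0.
    have /eqP := S0; rewrite psumr_eq0; last by move=> y _; exact: sqr_ge0.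
    by move/allP/(_ x xs).
  rewrite expf_eq0 /= mulf_eq0 => /orP[/eqP->|/eqP x4]; first by ring.
  have : (x - 2) * (x + 2) = 0 by rewrite -[RHS]x4; ring.
  by move/eqP; rewrite mulf_eq0 => /orP[] /eqP ?; [have -> : x = 2 by lra|]; lra.
by rewrite sumrB -mulr_sumr S2 natrM; lra.
Qed.

Section Degrees.
Variable G : sgraph.
Implicit Types a b c d u v x y : G.
Hypothesis degG : forall u : G, (0 < degree u <= 3)%N.

Definition degree_count k : nat := (\sum_(u : G) (degree u == k))%N.

Lemma sum_by_degree (F : nat -> int) : \sum_(u : G) F (degree u) =
  (degree_count 1)%:Z * F 1%N + (degree_count 2)%:Z * F 2%N
  + (degree_count 3)%:Z * F 3%N.
Proof.
rewrite !natz_sum !mulr_suml -!big_split; apply: eq_bigr => u _ /=.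
case: (degree u) (degG u) => [|[|[|[|k]]]] //= _;
  by rewrite !(mul0r, mul1r, addr0, add0r).
Qed.

Lemma degree_count_square a b c d k : square a b c d ->
  ((degree a == k) + (degree b == k) + (degree c == k) + (degree d == k)
   <= degree_count k)%N.
Proof.
move=> /square_uniq U; rewrite -(sum_seq4 (fun u => degree u == k : nat) U).
by rewrite /degree_count [leqRHS](bigID (mem [:: a; b; c; d])) leq_addr.
Qed.

Lemma iso_K22 a b c d : #|G| = 4%N -> square a b c d ->
  adj a c = false -> adj b d = false -> isomorphic G (complete_bipartite 2 2).
Proof.
move=> G4 sq ac bd; have /and5P[ab bc cd da _] := sq.
have [[nab nac nad] [nbc nbd ncd]] := square_neq sq.
have Gabcd x : [\/ x = a, x = b, x = c | x = d].
  have : x \in [:: a; b; c; d].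
    have C4 : #|[:: a; b; c; d]| = #|G|.
      by rewrite G4 (card_uniqP (square_uniq sq)).
    by rewrite (elimT (subset_cardP C4) (subset_predT _)).
  by rewrite !inE => /or4P[]/eqP->;
    [apply: Or41 | apply: Or42 | apply: Or43 | apply: Or44].
pose f x : complete_bipartite 2 2 :=
  if x == a then inl ord0 else if x == c then inl ord_max
  else if x == b then inr ord0 else inr ord_max.
have fa : f a = inl ord0 by rewrite /f eqxx.
have fc : f c = inl ord_max by rewrite /f eqxx eq_sym (negbTE nac).
have fb : f b = inr ord0 by rewrite /f eqxx eq_sym (negbTE nab) (negbTE nbc).
have fd : f d = inr ord_max.
  by rewrite /f !(eq_sym d) (negbTE nad) (negbTE nbd) (negbTE ncd).
exists f.
  apply: inj_card_bij; last by rewrite G4 card_sum card_ord.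
  move=> x y; have [->|->|->|->] := Gabcd x; have [->|->|->|->] := Gabcd y;
    by rewrite ?fa ?fb ?fc ?fd.
move=> x y; have [->|->|->|->] := Gabcd x; have [->|->|->|->] := Gabcd y;
  rewrite ?fa ?fb ?fc ?fd /= ?adj_irrefl ?ab ?bc ?cd ?da ?ac ?bd //;
  by rewrite adj_sym ?ab ?bc ?cd ?da ?ac ?bd.
Qed.

End Degrees.

(** * Graphs whose energy equals their order *)

Section EnergyEqOrder.
Variable G : sgraph.
Hypothesis G_unicyclic : unicyclic G.
Hypothesis G_energy : energy G = #|G|%:R.
Implicit Types a b c d u v : G.

Let G_conn : connected G := proj1 G_unicyclic.

Let card_edges : #|edges G| = #|G|.
Proof. by have := G_unicyclic.2; rewrite /cyclomatic; lia. Qed.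

Let excess : int := (\sum_(u : G) walks 4 u u)%N%:Z - 8 * #|G|%:Z.

Lemma energy_eq_order_bounds :
  [/\ 0 <= excess,
      excess = 0 -> cube_defect G = 0 &
      forall r t : algR, 2 <= r -> 0 <= t ->
        excess%:~R <= quartic r ->
        0 <= sextic r t #|G|%:R (2 * #|G|%:R) (8 * #|G|%:R + excess%:~R)
               ((cube_defect G)%:~R + 32 * #|G|%:R + 8 * excess%:~R)].
Proof.
have [s s0 sE] := spectrum_norm G.
have m1 : \sum_(x <- s) x = #|G|%:R.
  apply: (fmorph_inj algRval); apply: etrans (esym (energy_norms sE)) _.
  by rewrite G_energy rmorph_nat.
have m2 : \sum_(x <- s) x ^+ 2 = 2 * #|G|%:R.
  by rewrite (even_moment sE 1) closed_walks2 handshake card_edges natrM.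
have m4 : \sum_(x <- s) x ^+ 4 = 8 * #|G|%:R + excess%:~R.
  rewrite (even_moment sE 2) /excess intrB intrM -!pmulrn; ring.
have m6 := sum_cube_defect sE.
split.
- by rewrite -(ler0z algR) (moment_excess_ge0 s0 m1 m2 m4).
- move=> e0; apply/eqP; rewrite -(intr_eq0 algR); apply/eqP.
  by apply: (moment_excess_eq0 s0 m1 m2 m4 m6); rewrite e0.
- by move=> r t; exact: (moment_sextic_ge0 s0 m1 m2 m4 m6).
Qed.

Hypothesis G_deg : (max_degree G <= 3)%N.

Let degG u : (0 < degree u <= 3)%N.
Proof.
rewrite (leq_trans (leq_bigmax u) G_deg) andbT.
by rewrite degree_gt0 // card_edges; case: G_conn.
Qed.

Let n1 := degree_count G 1.
Let n2 := degree_count G 2.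
Let n3 := degree_count G 3.

Let card_degrees : #|G| = (n1 + n2 + n3)%N.
Proof.
have := sum_by_degree degG (fun _ => 1); rewrite -(natz_sum (fun _ : G => 1%N)).
by rewrite sum1_card /n1 /n2 /n3 -[#|xpredT|]/#|G|; lia.
Qed.

(** With as many edges as vertices the average degree is 2, so degrees 1 and 3 balance. *)
Let leaves : n1 = n3.
Proof.
have := handshake G; rewrite card_edges => /(congr1 Posz); rewrite natz_sum.
rewrite (sum_by_degree degG Posz); have := card_degrees; rewrite /n1 /n2 /n3; lia.
Qed.

Let excess_squares : excess =
  (\sum_(u : G) \sum_(v : G) adj u v * squares_on u v)%N%:Z - 2 * n2%:Z.
Proof.
rewrite /excess closed_walks4_squares.
rewrite (sum_by_degree degG (fun k => 2 * k%:Z ^+ 2 - k%:Z)).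
have := card_degrees; have := leaves; rewrite /n1 /n2 /n3.
move: (\sum_u _)%N; lia.
Qed.

Let sum_weight : \sum_(u : G) (degree u)%:Z * degree_weight (degree u) =
  12 * n3%:Z - 2 * n2%:Z.
Proof.
rewrite (sum_by_degree degG (fun k => k%:Z * degree_weight k)).
have := leaves; rewrite /degree_weight /n1 /n2 /n3; lia.
Qed.

(** Without a 4-cycle the excess is [- 2 n2], so [n2] and the excess vanish and the defect is 0. But
    it is at least [12 n3], and [n3 > 0] because [G] is nonempty and [n1 = n3]. *)
Lemma exists_square : exists a b c d, square a b c d.
Proof.
have [|nosq] := boolP [exists a : G, exists b : G, exists c : G, exists d : G,
  square a b c d].
  by move=> /existsP[a /existsP[b /existsP[c /existsP[d sq]]]]; exists a, b, c, d.
exfalso.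
have sq0 u v : squares_on u v = 0%N.
  rewrite /squares_on big1 // => x _; rewrite big1 // => y _.
  case: (boolP (square u x y v)) => // sq; case/negP: nosq.
  apply/existsP; exists u; apply/existsP; exists x.
  by apply/existsP; exists y; apply/existsP; exists v.
have [] := energy_eq_order_bounds; rewrite excess_squares.
rewrite big1 => [|u _]; last by rewrite big1 // => v _; rewrite sq0 muln0.
have := cube_defect_squarefree sq0 degG; rewrite sum_weight.
have [] := G_conn; rewrite card_degrees.
have := leaves; move: n1 n2 n3 (cube_defect G); lia.
Qed.

Lemma energy_eq_order_K22 : isomorphic G (complete_bipartite 2 2).
Proof.
have [a [b [c [d sq]]]] := exists_square.
have sq1 := sq; rewrite square_rot in sq1.
have sq2 := sq1; rewrite square_rot in sq2.
have sq3 := sq2; rewrite square_rot in sq3.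
suff G4 : #|G| = 4%N.
  by apply: (iso_K22 G4 sq); [exact: (square_chordless G_conn card_edges sq)|
                              exact: (square_chordless G_conn card_edges sq1)].
have [] := energy_eq_order_bounds; rewrite excess_squares.
rewrite (sum_squares_on G_conn card_edges sq).
have := cube_defect_square G_conn card_edges sq degG; rewrite sum_weight.
have := degree_count_square 2 sq; have := degree_count_square 3 sq.
rewrite -/n2 -/n3.
have := degG d; have := degG c; have := degG b; have := degG a.
have ge2 (x y z w : G) : square x y z w -> (1 < degree x)%N.
  by move=> xyzw; rewrite (degree_outside G_conn card_edges xyzw).
have := ge2 _ _ _ _ sq; have := ge2 _ _ _ _ sq1.
have := ge2 _ _ _ _ sq2; have := ge2 _ _ _ _ sq3.
move: (cube_defect G) => T d2 c2 b2 a2 a3 b3 c3 d3 N3 N2 HT.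
(* If [k] cycle vertices have degree 2, the cycle terms add at least 8 and at least [32 - 12 k] to
   [sum_weight], and [k <= n2]. The sixteen choices of degrees 2 and 3 are checked. *)
have [T1 T2 N] : [/\ 12 * n3%:Z - 14 * n2%:Z + 32 <= T,
    12 * n3%:Z - 2 * n2%:Z + 8 <= T & (4 <= n2 + n3)%N].
  rewrite /edge_bonus /degree_weight in HT.
  move: a2 a3 b2 b3 c2 c3 d2 d3 N3 N2 HT; clear; move: n2 n3 => m2 m3.
  case: (degree a) => [|[|[|[|k]]]] //= _ _;
  case: (degree b) => [|[|[|[|k]]]] //= _ _;
  case: (degree c) => [|[|[|[|k]]]] //= _ _;
  case: (degree d) => [|[|[|[|k]]]] //= _ _;
  move=> N3 N2 HT; split; lia.
move=> e0 e1 e2; have nE := card_degrees; have n13 := leaves.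
(* The excess is now [8 - 2 n2], so [n2 <= 4]. At [n2 = 4] it vanishes, hence so does [T], and [T2]
   becomes [12 n3 <= 0], which leaves four vertices. *)
have [n2_lt4|n2_4] : (n2 < 4)%N \/ n2 = 4%N.
  by move: e0; clear; move: n2 => k; lia.
  (* The sixth moment enters [sextic] with the negative coefficient [- (r + 2 t)], so the lower
     bounds on [T] make it negative. The double zero [t = 9/5] serves all four cases. *)
  exfalso; move: e2; rewrite nE n13 !natrD intrB intrM -!pmulrn.
  have {}N : 4 <= n2%:R + n3%:R :> algR by rewrite -natrD ler_nat.
  move: T1 T2; rewrite -!(ler_int algR) !(intrD, mulrNz, intrM) -!pmulrn.
  move: (n3%:R) (T%:~R) N => m T'; rewrite /sextic /quartic => N.
  case: (n2) n2_lt4 N => [|[|[|[|//]]]] _ N T1 T2 H.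
  (* In each case [r] is such that [8 - 2 n2 <= quartic r]. *)
  - by have := H (27 / 10) (9 / 5); lra.
  - by have := H (13 / 5) (9 / 5); lra.
  - by have := H (5 / 2) (9 / 5); lra.
  - by have := H (12 / 5) (9 / 5); lra.
rewrite nE n13 n2_4; move: T2 e1; rewrite n2_4 => T2 /(_ erefl) T0.
by move: T2; rewrite T0; clear; move: n3 => m; lia.
Qed.

End EnergyEqOrder.

Theorem theorem2p6 (G : sgraph) (n : nat) (G_n : #|G| = n)
    (G_unicyclic : unicyclic G) (G_deg : (max_degree G <= 3)%N) :
  energy G = n%:R <-> isomorphic G (complete_bipartite 2 2).
Proof.
rewrite -G_n; split=> [G_energy|]; first exact: energy_eq_order_K22.
exact: energy_K22.
Qed.
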